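(* (a) There is an absolute constant $C$ such that for all integers $R\ge 2$ and $\delta\ge 1$ there exists a finite hypergraph $H$ in which every hyperedge has at most $R$ vertices and every vertex has degree at least $\delta$, such that $\mathsf{p}'(H)\le \max\{1, C\delta/\ln R\}$. (b) For every sequence of pairs of positive integers $(R_n,\delta_n)$ with $R_n\to\infty$, $\delta_n\to\infty$ and $\delta_n/\ln R_n\to\infty$, there exist finite hypergraphs $H_n$ in which every hyperedge has at most $R_n$ vertices and every vertex has degree at least $\delta_n$, such that $\mathsf{p}'(H_n)\le (1+o(1))\,\delta_n/\ln R_n$ as $n\to\infty$.
   Context: A hypergraph $H=(V,\mathcal{E})$ consists of a finite vertex set $V$ and a finite multiset $\mathcal{E}$ of subsets of $V$ (hyperedges). The degree of a vertex is the number of hyperedges containing it (with multiplicity). A set cover is a subfamily of $\mathcal{E}$ whose union is $V$. The cover-decomposition number $\mathsf{p}'(H)$ is the maximum $k$ such that $\mathcal{E}$ can be partitioned into $k$ set covers. *)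

(* Defs.v *)
From mathcomp Require Import all_boot all_order all_algebra.

Set Implicit Arguments.
Unset Strict Implicit.
Unset Printing Implicit Defensive.

(** The multiset of hyperedges is an indexed family: [hedge H] is a finite type
    of labels and [hset H e] the set of vertices of the hyperedge [e], so
    distinct labels may carry the same vertex set. *)
Record hypergraph := Hypergraph {
  vertex : finType;
  hedge : finType;
  hset : hedge -> {set vertex}
}.

(** Counted with multiplicity. *)
Definition degree (H : hypergraph) (v : vertex H) : nat :=
  #|[set e : hedge H | v \in hset e]|.

Definition set_cover (H : hypergraph) (F : {set hedge H}) : bool :=
  \bigcup_(e in F) hset e == [set: vertex H].

Definition cover_decomposition (H : hypergraph) (P : {set {set hedge H}}) : bool :=
  partition P [set: hedge H] && [forall F in P, set_cover F].

(** The blocks of a [partition] are nonempty; when [vertex H] is nonempty this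
    is no restriction on set covers.  If the whole family is not a
    set cover there may be no cover decomposition, and the value is then 0. *)
Definition cover_decomposition_number (H : hypergraph) : nat :=
  \max_(P : {set {set hedge H}} | cover_decomposition P) #|P|.

(** Nonemptiness of the vertex set excludes the degenerate hypergraph without
    vertices and hyperedges, which would satisfy every bound vacuously. *)
Definition size_degree_bounded (R delta : nat) (H : hypergraph) : Prop :=
  [/\ (0 < #|vertex H|)%N,
      forall e : hedge H, (#|hset e| <= R)%N
    & forall v : vertex H, (delta <= degree v)%N].

(* Main.v *)
(** If every set cover has at least [c] hyperedges, a decomposition has at most
    [#|hedge| / c] blocks; replacing each hyperedge by [t] copies multiplies the
    degrees by [t] and keeps the minimum size of a cover.  It is thus enough to
    find at most [R] sets of size [d] in ['I_m] (one per vertex, listing the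
    hyperedges containing it) such that every set of fewer than [c] labels
    is disjoint from one of them.  For (a) take all [d]-subsets of ['I_(2d-1)], with
    [c = d] and [d] about [log_4 R].  For (b) take [R] random [d]-subsets of
    ['I_m]: with [d = s(M+1)], [m = s(M+1)^2], [c = sM], a random [d]-set avoids
    a given set of fewer than [c] labels with probability at least
    [(1 - 1/(M+1))^d >= exp(-s(M+1)/M)], and a union bound over at most [2^m]
    sets succeeds as soon as [m exp(s(M+1)/M) < R]; so [s] can be about
    [(1 - O(1/M)) ln R], which gives [m / (cd) = (1 + O(1/M)) / ln R]. *)
Require Import Defs.
From mathcomp Require Import all_boot all_order all_algebra.
From mathcomp Require Import zify.

(** * From minimum covers to the decomposition number *)

Lemma cover_decomposition_number_mul_le (H : hypergraph) (c : nat) :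
  (forall B : {set hedge H}, set_cover B -> c <= #|B|) ->
  cover_decomposition_number H * c <= #|hedge H|.
Proof.
move=> cP; rewrite /cover_decomposition_number.
apply: (big_ind (fun k => k * c <= #|hedge H|)) => //.
  by move=> x y xc yc; rewrite maxnMl geq_max xc yc.
move=> P /andP[partP /forallP covP].
rewrite -cardsT (card_partition partP) -sum_nat_const.
by apply: leq_sum => B BP; apply: cP; have := covP B; rewrite BP.
Qed.

(** Let [v] lie in the [t] copies of each label of [F v]. Forgetting the copy index sends a cover
    with fewer than [c] hyperedges to fewer than [c] labels; some [F v] misses them, so [v] is
    uncovered. *)
Lemma exists_missed_family_hypergraph (V E : finType) (F : V -> {set E})
    (R d c t : nat) :
  0 < #|V| <= R -> (forall v, #|F v| = d) ->
  (forall S : {set E}, #|S| < c -> exists v, [disjoint F v & S]) ->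
  exists H : hypergraph, size_degree_bounded R (t * d) H /\
    cover_decomposition_number H * c <= t * #|E|.
Proof.
move=> /andP[V0 VR] Fd Fmiss.
pose H := @Hypergraph V ('I_t * E)%type (fun x => [set v | x.2 \in F v]).
exists H; split; first split => //=.
- by move=> e; apply: leq_trans VR; exact: max_card.
- move=> v; rewrite /degree /= -(Fd v) -[t in t * _]card_ord -cardsT -cardsX.
  by apply: subset_leq_card; apply/subsetP => -[j e]; rewrite !inE => /andP[].
apply: (@leq_trans #|hedge H|); last by rewrite card_prod card_ord.
apply: cover_decomposition_number_mul_le => B /eqP Bcov.
rewrite leqNgt; apply/negP => Bc.
have [|v /disjoint_setI0/setP vB] := Fmiss (snd @: B).
  exact: leq_ltn_trans (leq_imset_card _ _) Bc.
have : v \in \bigcup_(e in B) @hset H e by rewrite Bcov inE.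
case/bigcupP => -[j e] eB; rewrite inE /= => ev.
have := vB e; rewrite !inE ev /= => /negP; apply.
by apply/imsetP; exists (j, e).
Qed.

(** * Counting [d]-subsets that avoid a given set *)

Lemma card_draws_disjoint (E : finType) (S : {set E}) (d : nat) :
  #|[set A : {set E} | [disjoint A & S] & #|A| == d]| = 'C(#|E| - #|S|, d).
Proof.
have -> : #|E| - #|S| = #|~: S| by rewrite [RHS]cardsCs setCK.
rewrite -cards_draws; apply: eq_card => A.
by rewrite !inE -disjoints_subset.
Qed.

(** The union bound as a count: for each of at most [2 ^ m] sets [S], at most
    [('C(m, d) - 'C(m - c, d)) ^ N] of the ['C(m, d) ^ N] families have all members meeting [S]. *)
Lemma exists_missing_family (m d c N : nat) :
  2 ^ m * ('C(m, d) - 'C(m - c, d)) ^ N < 'C(m, d) ^ N ->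
  exists F : 'I_N -> {set 'I_m}, (forall v, #|F v| = d) /\
    forall S : {set 'I_m}, #|S| < c -> exists v, [disjoint F v & S].
Proof.
move=> small.
pose D : {set {set 'I_m}} := [set A : {set 'I_m} | #|A| == d].
pose hit (S : {set 'I_m}) := [set A in D | ~~ [disjoint A & S]].
have hit_card (S : {set 'I_m}) : #|S| < c ->
    #|hit S| <= 'C(m, d) - 'C(m - c, d).
  move=> Sc.
  have -> : hit S = D :\: [set A : {set 'I_m} | [disjoint A & S] & #|A| == d].
    by apply/setP => A; rewrite !inE; case: (#|A| == d) => //=;
      rewrite ?andbF ?andbT.
  rewrite cardsDS; last first.
    by apply/subsetP => A; rewrite !inE => /andP[].
  rewrite card_draws card_draws_disjoint card_ord leq_sub2l //.
  by apply: leq_bin2l; lia.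
pose bad := \bigcup_(S : {set 'I_m} | #|S| < c)
  [set F : {ffun 'I_N -> {set 'I_m}} | F \in ffun_on (mem (hit S))].
have bad_card : #|bad| <= 2 ^ m * ('C(m, d) - 'C(m - c, d)) ^ N.
  apply: (@leq_trans (\sum_(S : {set 'I_m} | #|S| < c) #|hit S| ^ N)).
    rewrite /bad; elim/big_rec2: _ => [|S k B Sc Bk]; first by rewrite cards0.
    apply: leq_trans (leq_card_setU _ _) _.
    by rewrite leq_add // cardsE card_ffun_on card_ord.
  apply: (@leq_trans (\sum_(S : {set 'I_m} | #|S| < c)
           ('C(m, d) - 'C(m - c, d)) ^ N)).
    by apply: leq_sum => S /hit_card; have [->|N0] := posnP N; rewrite ?expn0 ?leq_exp2r.
  rewrite sum_nat_const leq_mul2r; apply/orP; right.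
  apply: leq_trans (max_card _) _.
  by rewrite -cardsT -powersetT card_powerset cardsT card_ord.
have /subsetPn[F FD Fgood] :
    ~~ ([set F : {ffun 'I_N -> {set 'I_m}} | F \in ffun_on (mem D)] \subset bad).
  apply/negP => /subset_leq_card; apply/negP; rewrite -ltnNge.
  rewrite cardsE card_ffun_on card_draws !card_ord.
  exact: leq_ltn_trans bad_card small.
move: FD; rewrite inE => /ffun_onP FD.
exists F; split=> [v|S Sc]; first by have := FD v; rewrite inE => /eqP.
apply/existsP; apply: contraR Fgood; rewrite negb_exists => /forallP nd.
apply/bigcupP; exists S => //; rewrite inE; apply/ffun_onP => v.
by rewrite inE FD nd.
Qed.

(** The quotient of the binomials is a product of [d] factors [(a + k - c) / (a + k)], each at least
    [(a - c) / a]. *)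
Lemma bin_ratio_lb (a c d : nat) : c <= a ->
  (a - c) ^ d * 'C(a + d, d) <= a ^ d * 'C(a + d - c, d).
Proof.
move=> ca; rewrite -(leq_pmul2r (fact_gt0 d)) -!mulnA !bin_ffact !ffact_prod.
have expE x : x ^ d = \prod_(i < d) x by rewrite prod_nat_const card_ord.
rewrite !expE -!big_split /=.
apply: leq_prod => -[i id] _ /=.
have [k ->] : exists k, d = i + k by exists (d - i); lia.
have [b ->] : exists b, a = b + c by exists (a - c); lia.
have -> : b + c - c = b by lia.
have -> : b + c + (i + k) - i = b + c + k by lia.
have -> : b + c + (i + k) - c - i = b + k by lia.
nia.
Qed.

(** * The explicit family of all [d]-subsets *)

Lemma exists_hypergraph_all_draws (R d t : nat) :
  0 < d -> 2 ^ d.*2.-1 <= R ->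
  exists H : hypergraph, size_degree_bounded R (t * d) H /\
    cover_decomposition_number H * d <= t * d.*2.-1.
Proof.
move=> d0 dR; set m := d.*2.-1.
pose V := {A : {set 'I_m} | #|A| == d}.
have cardV : #|{: V}| = 'C(m, d).
  rewrite card_sig -[in RHS](card_ord m) -card_draws.
  by apply: eq_card => A; rewrite !inE.
have := exists_missed_family_hypergraph V 'I_m (fun v => val v) R d d t.
rewrite card_ord; apply.
- rewrite cardV bin_gt0; apply/andP; split; first by rewrite /m; lia.
  apply: leq_trans dR; rewrite -/m (expnDn 1 1).
  have dm : d < m.+1 by rewrite /m; lia.
  by rewrite (bigD1 (Ordinal dm)) //= !exp1n !muln1 leq_addr.
- by move=> v; apply/eqP; exact: (valP v).
- move=> S Sd.
  have : 0 < #|[set A : {set 'I_m} | [disjoint A & S] & #|A| == d]|.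
    rewrite card_draws_disjoint card_ord bin_gt0.
    apply: (@leq_trans (m - d.-1)); first by rewrite /m; lia.
    by rewrite leq_sub2l // -ltnS prednK.
  by move=> /card_gt0P[A]; rewrite inE => /andP[AS Ad]; exists (exist _ A Ad).
Qed.

From mathcomp Require Import all_classical all_reals all_analysis.
From mathcomp Require Import ring lra.
Import Order.TTheory GRing.Theory Num.Theory.
Import numFieldNormedType.Exports.
Local Open Scope classical_set_scope.
Local Open Scope ring_scope.

(** * The random family *)

Lemma exp2_le_expR (K : realType) (n : nat) : 2 ^+ n <= expR (n%:R : K).
Proof.
rewrite -[n%:R]mulr1 expRM_natl lerXn2r ?nnegrE ?expR_ge0 //.
by rewrite -natr1; exact: expR_ge1Dx.
Qed.

(** With [q] the probability that a random [d]-set avoids [c] fixed labels, the claim reads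
    [2 ^ m * (1 - q) ^ N < 1]. The left side is at most [expR (m - q * N)], and the hypothesis
    yields [m < q * N]. *)
Lemma union_bound_bin (K : realType) (M s N : nat) : (0 < M)%N -> (0 < s)%N ->
  (s * M.+1 ^ 2)%:R * expR (s%:R * (M.+1%:R / M%:R)) < N%:R :> K ->
  (2 ^ (s * M.+1 ^ 2) *
    ('C(s * M.+1 ^ 2, s * M.+1) -
     'C(s * M.+1 ^ 2 - s * M, s * M.+1)) ^ N
    < 'C(s * M.+1 ^ 2, s * M.+1) ^ N)%N.
Proof.
move=> M0 s0; set m := (s * M.+1 ^ 2)%N; set d := (s * M.+1)%N.
set c := (s * M)%N => mN.
have ma : m = (s * M * M.+1 + d)%N by rewrite /m /d; lia.
have dm : (d <= m)%N by rewrite ma leq_addl.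
(* Here [a = s * M * M.+1] and [a - c = s * M * M], so [(a - c) / a] is [M / M.+1]. *)
have ratio : (M ^ d * 'C(m, d) <= M.+1 ^ d * 'C(m - c, d))%N.
  have ca : (c <= s * M * M.+1)%N by rewrite /c leq_pmulr.
  have := bin_ratio_lb _ _ d ca; rewrite -ma.
  have -> : (s * M * M.+1 - c = s * M * M)%N by rewrite /c mulnS addKn.
  by rewrite !(expnMn (s * M)) -!mulnA leq_pmul2l // expn_gt0 muln_gt0 s0 M0.
have C0 : 0 < 'C(m, d)%:R :> K by rewrite ltr0n bin_gt0.
have M0' : 0 < M%:R :> K by rewrite ltr0n.
have CC : ('C(m - c, d) <= 'C(m, d))%N by apply: leq_bin2l; lia.
pose q : K := 'C(m - c, d)%:R / 'C(m, d)%:R.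
have qlb : expR (- (s%:R * (M.+1%:R / M%:R))) <= q.
  rewrite expRN /q ler_pdivlMr // mulrC ler_pdivrMr ?expR_gt0 //.
  have step : M.+1%:R / M%:R <= expR (M%:R^-1) :> K.
    apply: le_trans (expR_ge1Dx _).
    by rewrite -natr1 mulrDl divff ?gt_eqF // mul1r.
  have e1 : (M.+1%:R / M%:R) ^+ d <= expR (s%:R * (M.+1%:R / M%:R)) :> K.
    have -> : s%:R * (M.+1%:R / M%:R) = d%:R * M%:R^-1 :> K.
      by rewrite /d natrM mulrA.
    by rewrite expRM_natl lerXn2r ?nnegrE ?expR_ge0 // divr_ge0.
  apply: le_trans (ler_wpM2l (ler0n _ _) e1).
  rewrite expr_div_n mulrA ler_pdivlMr ?exprn_gt0 // -!natrX -!natrM ler_nat.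
  by rewrite mulnC [leqRHS]mulnC.
have mq : m%:R < q * N%:R.
  apply: lt_le_trans (ler_wpM2r (ler0n _ _) qlb).
  by rewrite expRN mulrC ltr_pdivlMr ?expR_gt0.
rewrite -(ltr_nat K) natrM !natrX (natrB _ CC).
have -> : 'C(m, d)%:R - 'C(m - c, d)%:R = 'C(m, d)%:R * (1 - q) :> K.
  by rewrite /q mulrBr mulr1 mulrC divfK ?gt_eqF.
have q1 : 0 <= 1 - q by rewrite subr_ge0 /q ler_pdivrMr // mul1r ler_nat.
rewrite exprMn mulrCA -[ltRHS]mulr1 ltr_pM2l ?exprn_gt0 //.
apply: (@le_lt_trans _ _ (expR m%:R * expR (- q) ^+ N)).
  rewrite ler_pM ?exprn_ge0 ?exp2_le_expR // lerXn2r ?nnegrE ?expR_ge0 //.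
  exact: expR_ge1Dx.
by rewrite -expRM_natl -expRD -[ltRHS]expR0 ltr_expR; lra.
Qed.

Lemma exists_hypergraph_random (K : realType) (M s R t : nat) :
  (0 < M)%N -> (0 < s)%N ->
  (s * M.+1 ^ 2)%:R * expR (s%:R * (M.+1%:R / M%:R)) < R%:R :> K ->
  exists H : hypergraph, size_degree_bounded R (t * (s * M.+1)) H /\
    (cover_decomposition_number H * (s * M) <= t * (s * M.+1 ^ 2))%N.
Proof.
move=> M0 s0 sR.
have [F [Fd Fmiss]] :=
  exists_missing_family _ _ _ _ (@union_bound_bin K M s R M0 s0 sR).
have R0 : (0 < R)%N.
  by rewrite -(ltr_nat K); apply: le_lt_trans sR; rewrite mulr_ge0 ?expR_ge0.
have := exists_missed_family_hypergraph _ _ F R _ (s * M) t.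
by rewrite !card_ord; apply; rewrite ?R0 /=.
Qed.

(** * Parameters for (a) *)

Lemma size_degree_boundedW (R delta delta' : nat) (H : hypergraph) :
  (delta' <= delta)%N -> size_degree_bounded R delta H ->
  size_degree_bounded R delta' H.
Proof. by move=> dd [H0 HR Hd]; split=> // v; apply: leq_trans dd (Hd v). Qed.

Lemma exists_hypergraph_lnR_bound (K : realType) :
  exists C : K, forall R delta : nat, (2 <= R)%N -> (1 <= delta)%N ->
    exists H : hypergraph, size_degree_bounded R delta H /\
      (cover_decomposition_number H)%:R
        <= Num.max 1 (C * delta%:R / ln (R%:R : K)).
Proof.
(* [12 = 3 * 4], from [ln R <= 3 * d] and, when [k >= 2], [k * d <= 4 * delta]. *)
exists 12 => R delta R2 delta1.
have R0 : (0 < R)%N by lia.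
pose d := ((trunc_log 2 R).+1)./2.
have tl0 : (0 < trunc_log 2 R)%N by rewrite trunc_log_gt0.
have d0 : (0 < d)%N by rewrite /d; lia.
have dR : (2 ^ d.*2.-1 <= R)%N.
  apply: leq_trans (trunc_logP (isT : 1 < 2)%N R0).
  by rewrite leq_exp2l // /d; lia.
have lnR : ln R%:R <= (3 * d)%:R :> K.
  rewrite -ler_expR lnK ?posrE ?ltr0n //.
  apply: le_trans (exp2_le_expR K _); rewrite -natrX ler_nat.
  apply: leq_trans (ltnW (trunc_log_ltn R (isT : 1 < 2)%N)) _.
  by rewrite leq_exp2l // /d; lia.
have lnR0 : 0 < ln R%:R :> K by rewrite ln_gt0 // ltr1n.
(* [delta / d] rounded up: for [delta <= d] it is [1], and then [k * d <= d.*2.-1] forces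
   [k <= 1]. *)
pose t := (delta.-1 %/ d).+1.
have [H [Hsd Hk]] := exists_hypergraph_all_draws R d t d0 dR.
exists H; split.
  apply: size_degree_boundedW Hsd.
  by have := ltn_ceil delta.-1 d0; rewrite -/t; lia.
move: Hk; set k := cover_decomposition_number H => Hk.
rewrite le_max lern1; have [//|k2 /=] := leqP k 1.
rewrite ler_pdivlMr //.
have dd : (d < delta)%N.
  rewrite ltnNge; apply/negP => ded; move: Hk.
  by rewrite /t divn_small; [nia|lia].
have kd : (k * d <= 4 * delta)%N.
  have := leq_trunc_div delta.-1 d; move: Hk; rewrite /t; nia.
apply: (le_trans (ler_wpM2l (ler0n _ _) lnR)).
by rewrite -!natrM ler_nat; lia.
Qed.

(** * Parameters for (b) *)

Lemma exists_hypergraph_asymptotic (K : realType) (M : nat) : (0 < M)%N ->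
  exists A : K, forall R delta : nat, (0 < R)%N -> A <= ln R%:R ->
    A <= delta%:R / ln R%:R ->
    exists H : hypergraph, size_degree_bounded R delta H /\
      (cover_decomposition_number H)%:R
        <= (1 + 10 / M%:R) * (delta%:R / ln (R%:R : K)).
Proof.
move=> M0; pose x : K := M%:R.
have x1 : 1 <= x by rewrite /x ler1n.
have x0 : 0 < x by lra.
have y1 : M.+1%:R = x + 1 by rewrite -natr1.
(* [A1] makes [expR (S / x)] exceed [x * (x + 1) ^+ 2]; [A2] pays for rounding [s] down, [A3] for
   rounding [t] up. *)
pose A1 := x * (x + 1) ^+ 2 * (x + 3); pose A2 := (x + 3) * (x + 4).
pose A3 := (x + 1) ^+ 2.
have A10 : 0 <= A1 by rewrite /A1 !mulr_ge0 //; lra.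
have A20 : 0 <= A2 by rewrite /A2 !mulr_ge0 //; lra.
have A31 : 1 <= A3 by rewrite /A3; nra.
exists (A1 + A2 + A3) => R delta R0; set l := ln R%:R => Al Ad.
have l0 : 0 < l by lra.
have [s /andP[sl ls]] : exists s : nat, s%:R <= l * x / (x + 3) < s.+1%:R.
  exists (Num.trunc (l * x / (x + 3))); apply: truncn_itv.
  by rewrite divr_ge0 ?mulr_ge0; lra.
rewrite -[s.+1%:R]natr1 in ls; set S : K := s%:R in sl ls *.
have lS : l * x / (x + 4) <= S.
  have : l * x / (x + 4) + 1 <= l * x / (x + 3).
    rewrite ler_pdivlMr; last lra.
    rewrite -subr_ge0.
    have -> : l * x - (l * x / (x + 4) + 1) * (x + 3) =
        (l * x - A2) / (x + 4) by rewrite /A2; field; lra.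
    by rewrite divr_ge0 //; nra.
  lra.
have S0 : 0 < S by apply: lt_le_trans lS; rewrite !mulr_gt0 ?invr_gt0 //; lra.
have s0 : (0 < s)%N by move: S0; rewrite ltr0n.
have Slb : x ^+ 2 * (x + 1) ^+ 2 < S + 1.
  apply: le_lt_trans ls; rewrite ler_pdivlMr; last lra.
  have -> : x ^+ 2 * (x + 1) ^+ 2 * (x + 3) = A1 * x by rewrite /A1; ring.
  by rewrite ler_pM2r //; lra.
have sR : (s * M.+1 ^ 2)%:R * expR (s%:R * (M.+1%:R / M%:R)) < R%:R :> K.
  rewrite natrM natrX y1 -/S -/x.
  pose u := S / x; have uS : S = u * x by rewrite divfK // gt_eqF.
  have u0 : 0 < u by rewrite divr_gt0.
  have B1 : x * (x + 1) ^+ 2 < expR u.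
    apply: lt_le_trans (expR_ge1Dx u); rewrite -(ltr_pM2r x0).
    move: Slb; rewrite uS; rewrite mulrDl mul1r expr2; lra.
  have B2 : u < expR u by apply: lt_le_trans (expR_ge1Dx u); lra.
  have lR : expR l = R%:R by rewrite lnK // posrE ltr0n.
  rewrite -lR; apply: (@lt_le_trans _ _ (expR (u * (x + 3)))); last first.
    rewrite ler_expR /u mulrAC ler_pdivrMr // -ler_pdivlMr //; lra.
  (* The two spare terms [u] in the exponent absorb the factors [u] and [x * (x + 1) ^+ 2] of
     [m]. *)
  have -> : u * (x + 3) = u + u + S * ((x + 1) / x).
    by rewrite uS; field; lra.
  rewrite !expRD ltr_pM2r ?expR_gt0 // uS -mulrA.
  apply: ltr_pM B2 B1; first exact: ltW.
  by rewrite mulr_ge0 ?sqr_ge0 ?ltW.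
pose d := (s * M.+1)%N.
have d0 : (0 < d)%N by rewrite muln_gt0 s0.
pose t := (delta %/ d).+1.
have [H [Hsd Hk]] := @exists_hypergraph_random K M s R t M0 s0 sR.
exists H; split.
  by apply: size_degree_boundedW Hsd; apply: ltnW; exact: ltn_ceil.
move: Hk; set k := cover_decomposition_number H => Hk.
have {}Hk : (k * M <= t * M.+1 ^ 2)%N.
  by move: Hk; rewrite mulnCA [leqRHS]mulnCA leq_pmul2l.
have {}Hk : k%:R * x <= t%:R * (x + 1) ^+ 2.
  by rewrite -y1 -natrX -!natrM ler_nat.
have Ht : t%:R * (S * (x + 1)) <= delta%:R + S * (x + 1).
  rewrite -y1 -!natrM -natrD ler_nat /t mulSn addnC leq_add2r.
  exact: leq_trunc_div.
set D := delta%:R / l.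
have dD : delta%:R = D * l by rewrite divfK // gt_eqF.
have D0 : A3 <= D by rewrite /D; lra.
have DS : delta%:R <= D * (S * (x + 4)) / x.
  rewrite dD ler_pdivlMr // -mulrA ler_pM2l; last lra.
  by rewrite -ler_pdivrMr //; lra.
have kx : k%:R * x <= (x + 1) * (delta%:R / S) + A3.
  apply: (le_trans Hk); rewrite -(ler_pM2r S0).
  have -> : ((x + 1) * (delta%:R / S) + A3) * S =
      (x + 1) * (delta%:R + S * (x + 1)) by rewrite /A3; field; lra.
  have -> : t%:R * (x + 1) ^+ 2 * S = (x + 1) * (t%:R * (S * (x + 1))) by ring.
  by rewrite ler_pM2l //; lra.
have {}DS : delta%:R / S <= D * (x + 4) / x.
  by rewrite ler_pdivrMr // mulrAC -[D * _ * _]mulrA [(x + 4) * S]mulrC.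
rewrite -(ler_pM2r x0); apply: (le_trans kx).
apply: (@le_trans _ _ ((x + 1) * (D * (x + 4) / x) + D)).
  by apply: lerD => //; rewrite ler_pM2l //; lra.
(* [(x + 1) * (x + 4) / x + 1 = x + 6 + 4 / x], at most [x + 10] since [x >= 1]. *)
rewrite -subr_ge0.
have -> : (1 + 10 / x) * D * x - ((x + 1) * (D * (x + 4) / x) + D) =
    D * (4 * x - 4) / x by field; lra.
apply: divr_ge0; last lra.
by apply: mulr_ge0; lra.
Qed.

(** * Minimal hypergraphs and the limit *)

(** One vertex in [delta] copies of a single hyperedge; [c = 0] makes the condition on missed sets
    vacuous. *)
Lemma exists_size_degree_bounded (R delta : nat) : (0 < R)%N ->
  exists H, size_degree_bounded R delta H.
Proof.
move=> R0.
have := exists_missed_family_hypergraph unit unit (fun=> [set: unit]%SET) R 1 0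
  delta.
rewrite card_unit R0 muln1 => -[//|v|//|H [HH _]]; last by exists H.
by rewrite cardsT card_unit.
Qed.

Lemma exists_min_cover_decomposition_number (R delta : nat) : (0 < R)%N ->
  exists H, size_degree_bounded R delta H /\
    forall H', size_degree_bounded R delta H' ->
      (cover_decomposition_number H <= cover_decomposition_number H')%N.
Proof.
move=> /exists_size_degree_bounded-/(_ delta)[H0 HH0].
pose P k := `[< exists2 H, size_degree_bounded R delta H &
  cover_decomposition_number H = k >].
have exP : exists k, P k.
  by exists (cover_decomposition_number H0); apply/asboolP; exists H0.
case: (ex_minnP exP) => k /asboolP[H HH <-] kmin.
by exists H; split=> // H' HH'; apply: kmin; apply/asboolP; exists H'.
Qed.

Theorem theorem2 (K : realType) :
  (exists C : K, forall R delta : nat, (2 <= R)%N -> (1 <= delta)%N ->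
     exists H : hypergraph, size_degree_bounded R delta H /\
       (cover_decomposition_number H)%:R
         <= Num.max 1 (C * delta%:R / ln (R%:R : K)))
  /\
  (forall R delta : nat -> nat,
     (forall n, (0 < R n)%N) -> (forall n, (0 < delta n)%N) ->
     R n @[n --> \oo] --> \oo ->
     delta n @[n --> \oo] --> \oo ->
     (delta n)%:R / ln ((R n)%:R : K) @[n --> \oo] --> +oo ->
     exists H : nat -> hypergraph,
       (forall n, size_degree_bounded (R n) (delta n) (H n)) /\
       exists2 eps : nat -> K, eps n @[n --> \oo] --> (0 : K) &
         \forall n \near \oo,
           (cover_decomposition_number (H n))%:R
             <= (1 + eps n) * ((delta n)%:R / ln ((R n)%:R : K))).
Proof.
split; first exact: exists_hypergraph_lnR_bound.
move=> R delta R0 delta0 Roo _ Doo.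
(* Minimal hypergraphs satisfy the bounds obtained for all [M] at once, so no
   diagonal choice of [M] in terms of [n] is needed. *)
have [H HP] := choice (fun n =>
  exists_min_cover_decomposition_number _ (delta n) (R0 n)).
exists H; split=> [n|]; first by case: (HP n).
pose D n : K := (delta n)%:R / ln (R n)%:R.
pose k n : K := (cover_decomposition_number (H n))%:R.
(* The relative excess of [k n] over [D n], cut off at [0], so that convergence needs only eventual
   upper bounds on [k n / D n]. *)
exists (fun n => Num.max 0 (k n / D n - 1)); last first.
  near=> n; have Dn : 0 < D n.
    by near: n; move/cvgryPgt: Doo; apply.
  by rewrite -/(D n) -/(k n) -ler_pdivrMr // -lerBlDl le_max lexx orbT.
apply/cvgr0Pnorm_le => e e0.
pose M := (Num.trunc (10 / e)).+1.
have Me : 10 / M%:R <= e.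
  rewrite ler_pdivrMr ?ltr0n // -ler_pdivrMl // mulrC.
  have : 0 <= 10 / e by rewrite divr_ge0 // ltW.
  by move=> /trunc_itv/andP[_ /ltW].
have [A HA] := @exists_hypergraph_asymptotic K M isT.
near=> n.
have Dn : 0 < D n by near: n; move/cvgryPgt: Doo; apply.
have Rn : A <= ln (R n)%:R.
  have : ((Num.trunc (expR A)).+1 <= R n)%N by near: n; move/cvgnyPge: Roo; apply.
  move=> RA; rewrite -ler_expR lnK ?posrE ?ltr0n //.
  have /trunc_itv/andP[_ /ltW] := expR_ge0 A.
  by move=> /le_trans; apply; rewrite ler_nat.
have ADn : A <= D n by near: n; move/cvgryPge: Doo; apply.
have [H' [HH' kH']] := HA _ _ (R0 n) Rn ADn.
rewrite ger0_norm ?le_max ?lexx // ge_max ltW //= lerBlDl ler_pdivrMr //.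
have [_ /(_ _ HH') kk] := HP n.
apply: le_trans (le_trans kH' _); first by rewrite ler_nat.
by rewrite ler_pM2r // lerD2l.
Unshelve. all: by end_near.
Qed.
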